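(* (1) For every $n$, any local algorithm (in the adjacency list model) which, on every $n$-vertex unweighted undirected graph $G$ of maximum degree at most $2$, outputs with probability at least $0.6$ an approximation of the total effective resistance $R_{tot}(G)$ with approximation ratio less than $2$, must make $\Omega(n)$ queries. (2) For every $n$ and any $\ell=o(n)$, there exists $m$ such that any local algorithm which, on every input graph (with $n$ vertices and $m$ edges), outputs with probability at least $0.6$ an $\ell$-approximation of $R_{tot}(G)$ must make $\Omega(m/\ell)$ queries.
   Context: For an unweighted undirected graph $G=(V,E)$ with Laplacian $L_G=D_G-A_G$ and pseudo-inverse $L_G^{\dagger}$, the effective resistance between $u,v$ is $R_G(u,v)=(\mathbf{1}_u-\mathbf{1}_v)^{\top}L_G^{\dagger}(\mathbf{1}_u-\mathbf{1}_v)$, and the total effective resistance is $R_{tot}(G)=\sum_{u<v}R_G(u,v)$ over all unordered pairs of vertices. For $C>1$, a value $a$ is a $C$-approximation of $b$ if $a\in[b/C,b]$. In the adjacency list model, a local algorithm accesses the graph only via constant-time degree queries, neighbor queries (the $i$-th neighbor of a given vertex) and uniform vertex sampling; its query complexity is the number of such queries. *)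

(* Defs.v *)
From HB Require Import structures.
From mathcomp Require Import all_boot all_order all_algebra.
From mathcomp Require Import all_classical all_reals all_analysis.
Import Order.TTheory GRing.Theory Num.Theory.
Import numFieldNormedType.Exports.

Set Implicit Arguments.
Unset Strict Implicit.
Unset Printing Implicit Defensive.

Local Open Scope classical_set_scope.
Local Open Scope ring_scope.

(* A simple undirected graph on 'I_n together with the order, chosen
   arbitrarily (adversarially), in which each vertex lists its neighbours. *)
Record graph (n : nat) := Graph {
  nbrs : 'I_n -> seq 'I_n;
  nbrs_uniq : forall v, uniq (nbrs v);
  nbrs_irr : forall v, v \notin nbrs v;
  nbrs_sym : forall u v, (u \in nbrs v) = (v \in nbrs u) }.

Section Graphs.
Variables (n : nat) (G : graph n).

Definition adj (u v : 'I_n) : bool := v \in nbrs G u.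
Definition degree (v : 'I_n) : nat := size (nbrs G v).
Definition num_edges : nat :=
  #|[pred e : 'I_n * 'I_n | (e.1 < e.2)%N && adj e.1 e.2]|.

End Graphs.

Section PseudoInverse.
Variable R : realType.

Definition moore_penrose m n (A : 'M[R]_(m, n)) (X : 'M[R]_(n, m)) : Prop :=
  [/\ A *m X *m A = A, X *m A *m X = X,
      (A *m X)^T = A *m X & (X *m A)^T = X *m A].

(* [moore_penrose_ex] and [moore_penrose_uniq] show that the default value 0
   is never used and that the choice is canonical. *)
Definition pinv m n (A : 'M[R]_(m, n)) : 'M[R]_(n, m) :=
  xget 0 [set X | moore_penrose A X].

Lemma gram_unit m n (B : 'M[R]_(m, n)) : row_free B -> B *m B^T \in unitmx.
Proof.
move=> fB; rewrite -row_free_unit -kermx_eq0; apply/rowV0P => v.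
move=> /sub_kermxP; rewrite mulmxA => vBB.
have vB : v *m B = 0.
  have : (v *m B) *m (v *m B)^T = 0 by rewrite trmx_mul mulmxA vBB mul0mx.
  move=> /matrixP /(_ 0 0); rewrite !mxE.
  under eq_bigr do rewrite [in X in _ * X]mxE -expr2.
  move=> /eqP; rewrite psumr_eq0 => [|i _]; last exact: sqr_ge0.
  move=> /allP h; apply/matrixP => i j; rewrite !ord1.
  by have := h j (mem_index_enum _); rewrite /= sqrf_eq0 => /eqP ->; rewrite mxE.
by apply: (row_free_inj fB); rewrite vB mul0mx.
Qed.

Lemma moore_penrose_ex m n (A : 'M[R]_(m, n)) : exists X, moore_penrose A X.
Proof.
have [r [C [B [AE CU BU]]]] : exists r (C : 'M[R]_(m, r)) (B : 'M[R]_(r, n)),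
    [/\ A = C *m B, C^T *m C \in unitmx & B *m B^T \in unitmx].
  exists (\rank A), (col_base A), (row_base A); split.
  - by rewrite mulmx_base.
  - rewrite -{2}[col_base A]trmxK; apply: gram_unit.
    by rewrite /row_free mxrank_tr; exact: col_base_full.
  - by apply: gram_unit; exact: row_base_free.
pose U := invmx (B *m B^T); pose V := invmx (C^T *m C).
have UT : U^T = U by rewrite /U trmx_inv trmx_mul trmxK.
have VT : V^T = V by rewrite /V trmx_inv trmx_mul trmxK.
have BK : B *m (B^T *m U) = 1%:M by rewrite mulmxA mulmxV.
have CK : (V *m C^T) *m C = 1%:M by rewrite -mulmxA mulVmx.
have AX : A *m (B^T *m U *m (V *m C^T)) = C *m (V *m C^T).
  by rewrite AE -[C *m B *m _]mulmxA [B *m _]mulmxA BK mul1mx.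
have XA : (B^T *m U *m (V *m C^T)) *m A = B^T *m U *m B.
  by rewrite AE -[LHS]mulmxA [V *m _ *m _]mulmxA CK mul1mx.
exists (B^T *m U *m (V *m C^T)); split.
- by rewrite AX AE -[LHS]mulmxA [V *m _ *m _]mulmxA CK mul1mx.
- by rewrite XA -[LHS]mulmxA [B *m _]mulmxA BK mul1mx.
- by rewrite AX !trmx_mul trmxK VT mulmxA.
- by rewrite XA !trmx_mul trmxK UT mulmxA.
Qed.

Lemma moore_penrose_uniq m n (A : 'M[R]_(m, n)) X Y :
  moore_penrose A X -> moore_penrose A Y -> X = Y.
Proof.
move=> [x1 x2 x3 x4] [y1 y2 y3 y4].
have AXY : A *m X = A *m Y.
  rewrite -x3 -[in LHS]y1 -[_ *m A *m X]mulmxA trmx_mul x3 y3.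
  by rewrite mulmxA x1.
have XAY : X *m A = Y *m A.
  rewrite -x4 -[in LHS]y1 -[A *m Y *m A]mulmxA mulmxA trmx_mul x4 y4.
  by rewrite -mulmxA [A *m (X *m A)]mulmxA x1.
by rewrite -x2 -mulmxA AXY mulmxA XAY y2.
Qed.

Lemma pinvP m n (A : 'M[R]_(m, n)) : moore_penrose A (pinv A).
Proof. by have [X AX] := moore_penrose_ex A; exact: (xgetI 0 AX). Qed.

End PseudoInverse.

Section EffectiveResistance.
Variables (R : realType) (n : nat) (G : graph n).

Definition degree_mx : 'M[R]_n := diag_mx (\row_v (degree G v)%:R).
Definition adjacency_mx : 'M[R]_n := \matrix_(u, v) (adj G u v)%:R.
Definition laplacian : 'M[R]_n := degree_mx - adjacency_mx.

Definition effres (u v : 'I_n) : R :=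
  let x : 'cV[R]_n := delta_mx u 0 - delta_mx v 0 in
  (x^T *m pinv laplacian *m x) 0 0.

Definition total_effres : R :=
  \sum_(u < n) \sum_(v < n | (u < v)%N) effres u v.

End EffectiveResistance.

Definition approximates (R : realType) (C a b : R) : Prop := b / C <= a <= b.

(* Deterministic (apart from the answers to sampling queries) adaptive query
   strategies on n-vertex graphs; internal computation is unrestricted. *)
Inductive strategy (R : Type) (n : nat) : Type :=
| Output of R
| DegreeQuery of 'I_n & (nat -> strategy R n)
| NeighborQuery of 'I_n & nat & (option 'I_n -> strategy R n)
| SampleQuery of ('I_n -> strategy R n).

Section Run.
Variables (R : realType) (n : nat) (G : graph n).

(* Positions in adjacency lists are counted from 0; a neighbour query past the
   end of the list is answered by None. *)
Fixpoint output_prob (s : strategy R n) (B : set R) : R :=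
  match s with
  | Output a => \1_B a
  | DegreeQuery v k => output_prob (k (degree G v)) B
  | NeighborQuery v i k => output_prob (k (onth (nbrs G v) i)) B
  | SampleQuery k => n%:R^-1 * \sum_(v < n) output_prob (k v) B
  end.

(* Worst case over the answers to sampling queries. *)
Fixpoint num_queries (s : strategy R n) : nat :=
  match s with
  | Output _ => 0
  | DegreeQuery v k => (num_queries (k (degree G v))).+1
  | NeighborQuery v i k => (num_queries (k (onth (nbrs G v) i))).+1
  | SampleQuery k => (\max_(v < n) num_queries (k v)).+1
  end.

End Run.

(* A randomized algorithm draws a seed from an arbitrary probability space,
   independently of the uniform vertex samples, and then follows the strategy
   attached to that seed. *)
Record local_algorithm (R : realType) (n : nat) := LocalAlgorithm {
  seed_display : measure_display;
  seed : measurableType seed_display;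
  seed_law : probability seed R;
  strategy_of : seed -> strategy R n;
  output_prob_measurable : forall (G : graph n) (B : set R), measurable B ->
    measurable_fun [set: seed] (fun w => output_prob G (strategy_of w) B) }.

Section Algorithms.
Variables (R : realType) (n : nat) (A : local_algorithm R n).

Definition prob_output_in (G : graph n) (B : set R) : \bar R :=
  (\int[seed_law A]_w (output_prob G (strategy_of w) B)%:E)%E.

(* Worst case over the inputs in K and over all the randomness. *)
Definition query_complexity (K : set (graph n)) : \bar R :=
  ereal_sup [set x | exists2 G, K G &
    exists w : seed A, x = (num_queries G (strategy_of w))%:R%:E].

End Algorithms.

(* Main.v *)
(* The hard instances are 2-regular graphs, given by permutations [p] as
   v -- p v, so that they all have [n] edges.  The Green function of a cycle is
   quadratic, so a vertex on a cycle of length [t] contributes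
   (t - 1/t) / 12 to the trace of the pseudo-inverse of the Laplacian, and
   R_tot is [n] times this trace.  Hence R_tot is n (n^2 - 1) / 12 for the
   n-cycle but at most n^2 s / 6 once the cycle is cut into cycles of length
   between [s] and [2 s]: a ratio of about n / (2 s).  Cutting changes only the
   adjacency lists of at most 2 n / s vertices; averaging over the [n] rotated
   positions of the cuts, a run on the n-cycle with [q] queries meets a changed
   list with probability at most 2 q / s.  So distinguishing the two cases takes
   at least s / 10 queries.  Take s of order n / ell, with ell = 2 in part (1). *)

Require Import Defs.
From HB Require Import structures.
From mathcomp Require Import all_boot all_order all_algebra all_fingroup.
From mathcomp Require Import all_classical all_reals all_analysis.
From mathcomp Require Import measurable_realfun ring lra zify.
Import Order.TTheory GRing.Theory Num.Theory.
Import numFieldNormedType.Exports.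

Set Implicit Arguments.
Unset Strict Implicit.
Unset Printing Implicit Defensive.

Local Open Scope ring_scope.
(* all_classical has its own [pinv], the partial inverse of a function. *)
Local Notation pinv := Defs.pinv.

(** * One strategy run on two graphs *)

Section Queries.
Local Open Scope classical_set_scope.
Variables (R : realType) (n : nat).
Implicit Types (G : graph n) (s : strategy R n) (B C : set R).

Lemma output_prob_ge0 G s B : 0 <= output_prob G s B.
Proof.
elim: s => //= k IH.
by rewrite mulr_ge0 ?invr_ge0 ?sumr_ge0.
Qed.

Lemma average_le (F : 'I_n -> R) (c : R) :
  0 <= c -> (forall v, F v <= c) -> n%:R^-1 * (\sum_(v < n) F v) <= c.
Proof.
move=> c0 Fc; have [n0|n0] := posnP n.
  by rewrite [n in n%:R^-1]n0 invr0 mul0r.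
rewrite ler_pdivrMl ?ltr0n //; apply: (le_trans (ler_sum _ (fun v _ => Fc v))).
by rewrite sumr_const card_ord mulr_natl.
Qed.

Lemma output_prob_disjoint_le1 G s B C : B `&` C = set0 ->
  output_prob G s B + output_prob G s C <= 1.
Proof.
move=> BC; elim: s => //= [a|k IH].
  rewrite !indicE; have [aB|] := boolP (a \in B);
    have [aC|] := boolP (a \in C) => //=;
    rewrite ?addr0 ?add0r ?lexx //.
  have : (B `&` C) a by split; apply/set_mem.
  by rewrite BC.
by rewrite -mulrDr -big_split; apply: average_le.
Qed.

Lemma output_prob_le1 G s B : output_prob G s B <= 1.
Proof.
have /(output_prob_disjoint_le1 G s) : B `&` set0 = set0 by rewrite setI0.
by apply: le_trans; rewrite lerDl output_prob_ge0.
Qed.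

Lemma output_prob_dist_le1 G G' s s' B :
  `|output_prob G s B - output_prob G' s' B| <= 1.
Proof.
have [g0 g1] := (output_prob_ge0 G s B, output_prob_le1 G s B).
have [h0 h1] := (output_prob_ge0 G' s' B, output_prob_le1 G' s' B).
by rewrite ler_norml; lra.
Qed.

(** Hybrid argument by induction on the strategy. A query at [v] is answered differently for at most
    [N] indices, each charged at most [1]; for the others both runs enter the same continuation. A
    sampling query does not see the graph, so its bound is an average. *)
Lemma sum_output_prob_dist (I : finType) (N : nat) G (G_ : I -> graph n) s B :
  (forall v, (#|[pred i | nbrs (G_ i) v != nbrs G v]| <= N)%N) ->
  \sum_i `|output_prob G s B - output_prob (G_ i) s B|
    <= (N * num_queries G s)%:R.
Proof.
move=> GN.
(* Degree and neighbour answers are both a function [f] of the adjacency list, so one step serves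
   both. *)
have step v (T : Type) (f : seq 'I_n -> T) (k : T -> strategy R n) :
    (forall t, \sum_i `|output_prob G (k t) B - output_prob (G_ i) (k t) B|
       <= (N * num_queries G (k t))%:R) ->
    \sum_i `|output_prob G (k (f (nbrs G v))) B
             - output_prob (G_ i) (k (f (nbrs (G_ i) v))) B|
      <= (N * (num_queries G (k (f (nbrs G v)))).+1)%:R.
  move=> IH; rewrite mulnS natrD.
  set t := f (nbrs G v).
  apply: (@le_trans _ _ (\sum_i ((nbrs (G_ i) v != nbrs G v)%:R +
      `|output_prob G (k t) B - output_prob (G_ i) (k t) B|))); last first.
    rewrite big_split /= lerD // -natr_sum ler_nat.
    apply: leq_trans (GN v); rewrite -sum1_card [leqRHS]big_mkcond /=.
    by apply: leq_sum => i _; rewrite inE; case: (_ != _).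
  apply: ler_sum => i _; have [e|ne] := eqVneq (nbrs (G_ i) v) (nbrs G v).
    by rewrite e add0r.
  by apply: (le_trans (output_prob_dist_le1 _ _ _ _ _)); rewrite lerDl.
elim: s => [a|v k IH|v i k IH|k IH] /=.
- by rewrite muln0 big1 // => i _; rewrite subrr normr0.
- exact: (step v nat size k IH).
- exact: (step v _ (fun l => onth l i) k IH).
- apply: (@le_trans _ _ (n%:R^-1 *
    (\sum_(v < n) (N * num_queries G (k v))%:R))).
    apply: (@le_trans _ _ (n%:R^-1 * (\sum_(v < n) \sum_i
        `|output_prob G (k v) B - output_prob (G_ i) (k v) B|))).
      rewrite exchange_big /= [leRHS]mulr_sumr; apply: ler_sum => i _.
      rewrite -mulrBr normrM ger0_norm ?invr_ge0 // ler_wpM2l ?invr_ge0 //.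
      by rewrite -sumrB ler_norm_sum.
    by rewrite ler_wpM2l ?invr_ge0 // ler_sum.
  apply: average_le => // v; rewrite ler_nat leq_mul2l.
  by rewrite ltnW ?orbT // ltnS (leq_bigmax v).
Qed.
End Queries.

(** * Pseudo-inverse of a symmetric matrix *)

Section PinvSymmetric.
Variables (R : realType) (n : nat) (L : 'M[R]_n).
Hypothesis LT : L^T = L.

(** With [P = pinv L], symmetry of [L *m P] gives [P = P *m P^T *m L]. *)
Lemma pinv_mul_ker p (z : 'M[R]_(n, p)) : L *m z = 0 -> pinv L *m z = 0.
Proof.
move=> Lz; have [_ PLP LP _] := pinvP L.
by rewrite -PLP -[pinv L *m L *m _]mulmxA -LP trmx_mul LT -!mulmxA Lz !mulmx0.
Qed.

Lemma ker_mul_pinv p (z : 'M[R]_(n, p)) : L *m z = 0 -> z^T *m pinv L = 0.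
Proof.
move=> Lz; have [_ PLP _ PL] := pinvP L.
by rewrite -PLP -PL trmx_mul LT !mulmxA -[z^T *m L]trmxK trmx_mul trmxK LT Lz
  trmx0 !mul0mx.
Qed.

(** [pinv L] kills [z] on either side, and [L *m pinv L *m L = L] does the rest. Diagonal entries of
    [pinv L] thus follow from solving a Poisson equation modulo the kernel. *)
Lemma pinv_quad (b x z : 'cV[R]_n) : b = L *m x + z -> L *m z = 0 ->
  b^T *m pinv L *m b = x^T *m L *m x.
Proof.
move=> -> Lz; have [LPL _ _ _] := pinvP L.
rewrite -mulmxA mulmxDr (pinv_mul_ker Lz) addr0 linearD /= mulmxDl.
rewrite [z^T *m _]mulmxA (ker_mul_pinv Lz) mul0mx addr0 trmx_mul LT.
by rewrite -!mulmxA; congr (_ *m _); rewrite !mulmxA LPL.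
Qed.

End PinvSymmetric.

(** * Total effective resistance as a trace *)

Section TotalEffres.
Variables (R : realType) (n : nat) (G : graph n).
Local Notation L := (laplacian R G).

Lemma adj_sym u v : adj G u v = adj G v u.
Proof. by rewrite /adj nbrs_sym. Qed.

Lemma laplacian_tr : L^T = L.
Proof.
rewrite /laplacian linearB /= /degree_mx tr_diag_mx; congr (_ - _).
by apply/matrixP => u v; rewrite !mxE adj_sym.
Qed.

Lemma mul_laplacian (x : 'cV[R]_n) v :
  (L *m x) v 0 = \sum_(u <- nbrs G v) (x v 0 - x u 0).
Proof.
rewrite /laplacian mulmxBl mul_diag_mx !mxE sumrB; congr (_ - _).
  by rewrite big_const_seq count_predT iter_addr_0 mulr_natl.
rewrite [RHS]big_uniq ?nbrs_uniq // [RHS]big_mkcond /=; apply: eq_bigr => u _.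
by rewrite mxE /adj; case: ifP; rewrite ?mul1r ?mul0r.
Qed.

Lemma laplacian_const (a : R) : L *m const_mx a = 0 :> 'cV[R]_n.
Proof.
apply/colP => v; rewrite mul_laplacian big1 ?mxE // => u _.
by rewrite !mxE subrr.
Qed.

Lemma effresE u v : effres R G u v =
  pinv L u u + pinv L v v - pinv L u v - pinv L v u.
Proof.
have dP (x y : 'I_n) :
    ((delta_mx x 0)^T *m pinv L *m delta_mx y 0 : 'M[R]_1) 0 0
    = pinv L x y.
  by rewrite trmx_delta -rowE -colE !mxE.
rewrite /effres /= [(_ - _)^T]linearB /= !(mulmxBl, mulmxBr).
have E (A B C D : 'M[R]_1) : (A - B - (C - D)) 0 0
    = A 0 0 + D 0 0 - B 0 0 - C 0 0 by rewrite !mxE; ring.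
by rewrite E !dP; ring.
Qed.

(** When the resistances are expanded over ordered pairs, the mixed terms [pinv L u v] sum to [0]:
    constants lie in the kernel of [L], so [pinv L] kills them on both sides. *)
Lemma total_effres_trace : total_effres R G = n%:R * \tr (pinv L).
Proof.
have half : \sum_(u < n) \sum_(v < n) effres R G u v = total_effres R G *+ 2.
  have e0 u : effres R G u u = 0 by rewrite effresE; ring.
  have eC u v : effres R G u v = effres R G v u by rewrite !effresE; ring.
  rewrite /total_effres mulr2n.
  under eq_bigr => u _ do rewrite (bigID (fun v : 'I_n => (u < v)%N)) /=.
  rewrite big_split /=; congr (_ + _).
  rewrite (exchange_big_dep xpredT) //=; apply: eq_bigr => v _.
  rewrite (bigD1 v) ?ltnn //= e0 add0r; apply: eq_big => [u|u _]; last exact: eC.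
  by rewrite -leqNgt ltn_neqAle andbC eq_sym.
have one0 : L *m const_mx 1 = 0 :> 'cV[R]_n := laplacian_const 1.
have Prow u : \sum_v pinv L u v = 0.
  have := pinv_mul_ker laplacian_tr one0.
  move=> /colP/(_ u); rewrite !mxE => P0; rewrite -[RHS]P0.
  by apply: eq_bigr => v _; rewrite mxE mulr1.
have Pcol v : \sum_u pinv L u v = 0.
  have := ker_mul_pinv laplacian_tr one0.
  move=> /rowP/(_ v); rewrite !mxE => P0; rewrite -[RHS]P0.
  by apply: eq_bigr => u _; rewrite !mxE mul1r.
apply: (mulIf (_ : 2 != 0 :> R)) => //.
rewrite mulr_natr -half.
under eq_bigr => u _.
  under eq_bigr do rewrite effresE.
  rewrite !sumrB big_split /= Prow Pcol subr0 subr0 sumr_const card_ord.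
  over.
by rewrite big_split /= sumr_const card_ord sumrMnl -mulr2n /mxtrace; ring.
Qed.

End TotalEffres.

(** * 2-regular graphs from permutations *)

Section PermGraph.
Variables (n : nat) (p : {perm 'I_n}) (p2 : forall v, p (p v) != v).

(** [p2] rules out fixed points and 2-cycles, so the two entries differ from [v] and from each
    other. *)
Let perm_nbrs v := [:: p v; (p^-1)%g v].

Lemma perm_nbrs_uniq v : uniq (perm_nbrs v).
Proof. by rewrite /= inE andbT -(inj_eq (@perm_inj _ p)) permKV. Qed.

Lemma perm_nbrs_irr v : v \notin perm_nbrs v.
Proof.
have pv : p v != v by apply: contraNneq (p2 v) => pv; rewrite !pv.
by rewrite !inE negb_or eq_sym pv -(inj_eq (@perm_inj _ p)) permKV.
Qed.

Lemma perm_nbrs_sym u v : (u \in perm_nbrs v) = (v \in perm_nbrs u).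
Proof.
have E x y : (x == (p^-1)%g y) = (p x == y).
  by rewrite -(inj_eq (@perm_inj _ p)) permKV.
by rewrite !inE !E orbC ![_ == p _]eq_sym.
Qed.

Definition perm_graph := Graph perm_nbrs_uniq perm_nbrs_irr perm_nbrs_sym.

Lemma degree_perm_graph v : degree perm_graph v = 2%N.
Proof. by []. Qed.

Variable R : realType.
Local Notation L := (laplacian R perm_graph).

Lemma mul_laplacian_perm (x : 'cV[R]_n) v :
  (L *m x) v 0 = 2 * x v 0 - x (p v) 0 - x ((p^-1)%g v) 0.
Proof. by rewrite mul_laplacian /= !big_cons big_nil; ring. Qed.

Lemma porbit_stable u v : (p v \in porbit p u) = (v \in porbit p u).
Proof. by rewrite -!eq_porbit_mem; have := porbit_perm p 1 v; rewrite expg1 => ->. Qed.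

(** [s] is kept apart from [m] so that the induction goes through; at [s = m] the value is
    [m (m^2 - 1) / 6]. *)
Lemma sum_mul_sub (m : nat) (s : R) :
  \sum_(d < m) (d%:R * (s - d%:R)) =
  m%:R * (m%:R - 1) * (3 * s - 2 * m%:R + 1) / 6.
Proof.
elim: m => [|m IH]; first by rewrite big_ord0 !mul0r.
by rewrite big_ord_recr /= IH -natr1; field.
Qed.

(** With [z] uniform on the orbit, hence constant on components and in the kernel, the parabola [g]
    solves [L h = z - delta_u]: its second difference is [- 1 / s], and it has a kink at [u]. As [h]
    vanishes at [u], the wanted entry is the mean of [h] over the orbit. *)
Lemma pinv_laplacian_perm_diag u (s := #|porbit p u|%:R : R) :
  pinv L u u = (s - s^-1) / 12.
Proof.
set m := #|porbit p u| in s *; pose t := traject p u m.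
have m0 : (0 < m)%N by rewrite lt0n card_porbit_neq0.
have s0 : s != 0 by rewrite pnatr_eq0 -lt0n.
pose g d : R := d%:R * (s - d%:R) / (2 * s).
(* [h] vanishes outside the orbit of [u], since [index k t] is then [m] and
   [g m = 0]; the same equation makes [h] consistent around the cycle. *)
pose h : 'cV[R]_n := \col_k g (index k t).
pose z : 'cV[R]_n := \col_k ((k \in porbit p u)%:R / s).
have memt k : (k \in t) = (k \in porbit p u) by rewrite porbit_traject.
have gm : g m = 0 by rewrite /g subrr mulr0 mul0r.
have index_t d : (d < m)%N -> index (iter d p u) t = d.
  move=> dm; rewrite -(nth_traject p dm u) index_uniq ?size_traject //.
  exact: uniq_traject_porbit.
have hi d : (d <= m)%N -> h (iter d p u) 0 = g d.
  rewrite leq_eqVlt => /orP[/eqP ->|dm]; last by rewrite mxE index_t.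
  rewrite iter_porbit gm mxE -[u in index u]/(iter 0 p u) index_t //.
  by rewrite /g !mul0r.
have ho k : k \notin porbit p u -> h k 0 = 0.
  by rewrite mxE -memt => /memNindex ->; rewrite size_traject.
have Lz : L *m z = 0.
  apply/colP => k; rewrite mul_laplacian_perm !mxE porbit_stable.
  by rewrite -(porbit_stable u ((p^-1)%g k)) permKV; ring.
have Lh : L *m h = z - delta_mx u 0.
  apply/colP => k; rewrite mul_laplacian_perm.
  have -> : (z - delta_mx u 0) k 0 = (k \in porbit p u)%:R / s - (k == u)%:R.
    by rewrite !mxE eqxx andbT.
  have [kO|kO] := boolP (k \in porbit p u); last first.
    have pkO : p k \notin porbit p u by rewrite porbit_stable.
    have qkO : (p^-1)%g k \notin porbit p u by rewrite -porbit_stable permKV.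
    rewrite (ho _ kO) (ho _ pkO) (ho _ qkO).
    suff /negPf -> : k != u by rewrite mulr0 !subr0 mul0r.
    by apply: contraNneq kO => ->; exact: porbit_id.
  have [d dm ->] : exists2 d, (d < m)%N & k = iter d p u.
    by apply/trajectP; rewrite -memt in kO.
  have -> : (iter d p u == u) = (d == 0)%N.
    apply/eqP/eqP => [E|-> //]; rewrite -(index_t _ dm) E.
    exact: (index_t 0).
  rewrite -iterS !hi ?(ltnW dm) //.
  (* At [d = 0] the predecessor is the last point of the orbit; the wrap produces the [- 1] of
     [delta_mx u 0]. *)
  case: d dm => [|d] dm.
    have -> : (p^-1)%g (iter 0 p u) = iter m.-1 p u.
      by apply: (@perm_inj _ p); rewrite permKV -iterS prednK // iter_porbit.
    by rewrite hi ?leq_pred // /g -subn1 natrB // -/s eqxx !mulr1n; field.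
  rewrite [iter d.+1 p u]iterS permK hi ?(ltnW (ltnW dm)) //.
  by rewrite /g -!natr1 /= subr0; field.
have E : delta_mx u 0 = L *m (- h) + z by rewrite mulmxN Lh opprB subrK.
have <- :
    ((delta_mx u 0)^T *m pinv L *m delta_mx u 0 : 'M[R]_1) 0 0 = pinv L u u.
  by rewrite trmx_delta -rowE -colE !mxE.
rewrite (pinv_quad (laplacian_tr R perm_graph) E Lz).
have -> : (- h)^T *m L *m (- h) = h^T *m (z - delta_mx u 0).
  by rewrite [(- h)^T]linearN /= mulmxN !mulNmx opprK -mulmxA Lh.
have -> : (h^T *m (z - delta_mx u 0)) 0 0 = (\sum_(k in porbit p u) h k 0) / s.
  have hu : h u 0 = 0 by rewrite (hi 0) // /g !mul0r.
  have AB (A B : 'M[R]_1) : (A - B) 0 0 = A 0 0 - B 0 0 by rewrite !mxE.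
  rewrite mulmxBr -colE AB [col _ _ _ _]mxE [h^T _ _]mxE hu [X in X - _]mxE.
  rewrite subr0 mulr_suml [RHS]big_mkcond; apply: eq_bigr => k _.
  by rewrite !mxE; case: ifP; rewrite ?mul1r // mul0r mulr0.
rewrite -(eq_bigl _ _ memt) -big_uniq ?uniq_traject_porbit //.
rewrite (big_nth u) size_traject big_mkord.
under eq_bigr => d _ do rewrite nth_traject // hi ?(ltnW (ltn_ord d)) //.
rewrite /g -mulr_suml sum_mul_sub -/s; field.
by rewrite s0.
Qed.

Lemma total_effres_perm_graph :
  total_effres R perm_graph = n%:R / 12 *
    \sum_u (#|porbit p u|%:R - #|porbit p u|%:R^-1).
Proof.
rewrite total_effres_trace /mxtrace -mulrA; congr (_ * _).
by rewrite mulr_sumr; apply: eq_bigr => u _; rewrite pinv_laplacian_perm_diag mulrC.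
Qed.

(** Handshake count: all degrees are [2], and ordered adjacent pairs count each edge twice. *)
Lemma num_edges_perm_graph : num_edges perm_graph = n.
Proof.
have sumdeg : (\sum_(u < n) \sum_(v < n) adj perm_graph u v = 2 * n)%N.
  rewrite -[n in RHS]card_ord mulnC -sum_nat_const; apply: eq_bigr => u _.
  rewrite -(degree_perm_graph u) /degree -sum1_size [RHS]big_uniq ?nbrs_uniq //=.
  by rewrite [RHS]big_mkcond; apply: eq_bigr => v _; rewrite /adj; case: ifP.
have edgesE : num_edges perm_graph =
    (\sum_(u < n) \sum_(v < n | (u < v)%N) adj perm_graph u v)%N.
  rewrite /num_edges -sum1_card [RHS]pair_big_dep /= [LHS]big_mkcondr /=.
  by apply: eq_bigr => e _; case: ifP.
apply/eqP; rewrite -(eqn_pmul2l (isT : 0 < 2)%N) -sumdeg mul2n -addnn edgesE.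
under [X in _ == X]eq_bigr => u _
  do rewrite (bigID (fun v : 'I_n => (u < v)%N)) /=.
rewrite big_split /= eqn_add2l; apply/eqP.
rewrite [RHS](exchange_big_dep xpredT) //=; apply: eq_bigr => v _.
rewrite [RHS](bigD1 v) ?ltnn //= [adj _ v v](negPf (nbrs_irr _ _)) add0n.
apply: eq_big => [u|u _]; last by rewrite adj_sym.
by rewrite -leqNgt ltn_neqAle andbC eq_sym.
Qed.

End PermGraph.

(** * The n-cycle and its rotations *)

Section Cycle.
Variable n : nat.

Definition cycle_perm : {perm 'I_n} := perm (@ordS_inj n).

Lemma cycle_permX i (v : 'I_n) : ((cycle_perm ^+ i)%g v = (v + i) %% n :> nat)%N.
Proof.
elim: i => [|i IH]; first by rewrite expg0 perm1 addn0 modn_small.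
by rewrite expgSr permM permE /= IH -addn1 modnDml addn1 addnS.
Qed.

Lemma cycle_permX_inj (v : 'I_n) :
  injective (fun i : 'I_n => (cycle_perm ^+ i)%g v).
Proof.
move=> i j /(congr1 val); rewrite /= !cycle_permX => /eqP.
by rewrite eqn_modDl !modn_small // => /eqP /val_inj.
Qed.

Lemma card_porbit_cycle v : #|porbit cycle_perm v| = n.
Proof.
rewrite -[RHS]card_ord; apply: eq_card => w; rewrite inE.
apply/porbitP; exists (w + (n - v))%N; apply: val_inj.
by rewrite /= cycle_permX addnCA subnKC ?modnDr ?modn_small // ltnW.
Qed.

Lemma cycle_perm2 : (2 < n)%N -> forall v, cycle_perm (cycle_perm v) != v.
Proof.
move=> n2 v; apply/eqP => /(congr1 val).
rewrite -permM -expg2 /= cycle_permX; have vn := ltn_ord v.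
have [lt|le] := ltnP (v + 2) n; first by rewrite modn_small //; lia.
by rewrite -(subnK le) modnDr modn_small; lia.
Qed.

End Cycle.

(** * Cutting the cycle into blocks *)

Lemma card_porbit_le (T : finType) (U : eqType) (f : T -> U) (p : {perm T}) x :
  (forall v, f (p v) = f v) ->
  (#|porbit p x| <= #|[pred v | f v == f x]|)%N.
Proof.
move=> fp; apply/subset_leq_card/fintype.subsetP => y /porbitP[i ->]; rewrite inE.
elim: i => [|i /eqP <-]; first by rewrite expg0 perm1.
by rewrite expgSr permM fp.
Qed.

Section Blocks.
Local Open Scope nat_scope.
Variables (n s : nat) (s3 : (2 < s)) (sn : (s <= n)).

Let K := n %/ s.
Let s0 : (0 < s) := ltnW (ltnW s3).
Let K0 : (0 < K).
Proof. by rewrite divn_gt0. Qed.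
Let Ks : (K * s <= n) := leq_divM n s.

Let blk v := minn (v %/ s) K.-1.
(* The blocks are [j s, (j + 1) s), the last one being extended up to [n]. *)
Let next v :=
  if (v.+1 < n) && (blk v.+1 == blk v) then v.+1 else blk v * s.
Let block_end v := ~~ ((v.+1 < n) && (blk v.+1 == blk v)).

Let blk_lt v : (blk v < K).
Proof. by rewrite -(prednK K0) ltnS geq_minr. Qed.

Let blk_start v : (blk v * s <= v).
Proof. by rewrite (leq_trans _ (leq_divM v s)) // leq_mul2r geq_minl orbT. Qed.

Let blk_mul b : (b < K) -> blk (b * s) = b.
Proof. by move=> bK; rewrite /blk mulnK //; apply/minn_idPl; rewrite -ltnS prednK. Qed.

Let blk_mono u v : (u <= v) -> (blk u <= blk v).
Proof.
by move=> uv; rewrite leq_min geq_minr andbT (leq_trans (geq_minl _ _)) ?leq_div2r.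
Qed.

Let blk_next v : blk (next v) = blk v.
Proof.
rewrite /next; case: ifP => [/andP[_ /eqP]//|_].
exact: blk_mul.
Qed.

(** Source of the lower bound on block lengths: after a block end comes either a later block or [n],
    and [K * s <= n]. *)
Let block_end_ge v : (v < n) -> block_end v -> ((blk v).+1 * s <= v.+1).
Proof.
move=> vn; rewrite /block_end negb_and -leqNgt => /orP[nv|ne].
  by apply: leq_trans nv; apply: leq_trans Ks; rewrite leq_mul2r blk_lt orbT.
have lt : (blk v < blk v.+1) by rewrite ltn_neqAle eq_sym ne blk_mono.
by apply: leq_trans (blk_start v.+1); rewrite leq_mul2r lt orbT.
Qed.

(** Only the last block can exceed [s] vertices, by the remainder of [n] modulo [s]. *)
Let blk_itv v : (v < n) -> (blk v * s <= v < blk v * s + 2 * s).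
Proof.
move=> vn; rewrite blk_start /= -mulnDl -ltn_divLR //.
rewrite /blk; case: (leqP (v %/ s) K.-1) => [vK|Kv]; first by rewrite addn2 leqW.
by rewrite addn2 prednK // ltnS leq_div2r // ltnW.
Qed.

Let block_end_inj u v : (u < n) -> (v < n) -> block_end u -> block_end v ->
  blk u = blk v -> u = v.
Proof.
have main x y : (y < n) -> block_end x -> blk x = blk y -> ~~ (x < y).
  move=> yn ex bxy; apply: contraL ex => xy; rewrite /block_end negbK.
  rewrite (leq_ltn_trans xy yn) /= eqn_leq [blk x <= _]blk_mono // andbT.
  by rewrite bxy blk_mono.
move=> un vn eu ev buv; apply/eqP; rewrite eqn_leq.
by rewrite leqNgt main //= leqNgt main.
Qed.

(** [next] stays within a block, where only the end wraps to the start, and a step to [v.+1] never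
    reaches that start. *)
Let next_inj u v : (u < n) -> (v < n) -> next u = next v -> u = v.
Proof.
have main x y : block_end x -> ~~ block_end y -> next x = next y ->
    blk x = blk y -> False.
  rewrite /block_end /next negbK => /negPf-> -> xy bxy.
  by have := blk_start y; rewrite -bxy xy ltnn.
move=> un vn e; have b : blk u = blk v by rewrite -blk_next e blk_next.
have [eu|nu] := boolP (block_end u); have [ev|nv] := boolP (block_end v).
- exact: block_end_inj.
- by case: (main u v).
- by case: (main v u).
- by move: nu nv e; rewrite /block_end /next !negbK => -> -> [].
Qed.

Let next_lt v : (v < n) -> (next v < n).
Proof.
by rewrite /next => vn; case: ifP => [/andP[]//|_]; apply: leq_ltn_trans vn.
Qed.

Let next2 v : (v < n) -> next (next v) != v.
Proof.
move=> vn; apply/eqP.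
(* A wrap moves back by at least [2], since blocks have at least three vertices; one step forward
   cannot undo it. *)
have E w : (w < n) -> next w = w.+1 \/
    next w = (blk w * s) /\ (blk w * s + 2 <= w).
  move=> wn; have := @block_end_ge w wn.
  rewrite /block_end /next; case: ifP => _ H; [by left|right; split=> //].
  by have := H isT; lia.
have := E _ (next_lt vn).
by case: (E v vn) => [->|[-> ?]] [->|[-> ?]]; lia.
Qed.

Let next_ord (v : 'I_n) : 'I_n := Ordinal (next_lt (ltn_ord v)).

Let next_ord_inj : injective next_ord.
Proof. by move=> u v /(congr1 val) /next_inj uv; apply/val_inj/uv. Qed.

Definition block_perm : {perm 'I_n} := perm next_ord_inj.

Lemma block_perm2 v : block_perm (block_perm v) != v.
Proof. by rewrite !permE; exact: next2. Qed.

(** Conjugation moves every cut [i] places along the cycle. *)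
Definition rotated_block_perm i := (block_perm ^ (cycle_perm n ^+ i))%g.

Lemma rotated_block_permE i v : rotated_block_perm i v =
  (cycle_perm n ^+ i)%g (block_perm ((cycle_perm n ^+ i)^-1%g v)).
Proof. by rewrite -[v in LHS](permKV (cycle_perm n ^+ i)%g) permJ. Qed.

Lemma rotated_block_perm2 i v : rotated_block_perm i (rotated_block_perm i v) != v.
Proof.
rewrite !rotated_block_permE permK.
rewrite -[v in _ != v](permKV (cycle_perm n ^+ i)%g) (inj_eq perm_inj).
exact: block_perm2.
Qed.

(** The block number of the vertex rotated back is constant on orbits, and a block lies in an
    interval of length [2 * s]. *)
Lemma card_porbit_rotated i v : #|porbit (rotated_block_perm i) v| <= 2 * s.
Proof.
pose t := (cycle_perm n ^+ i)%g; pose f (u : 'I_n) := blk (t^-1%g u).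
have fp u : f (rotated_block_perm i u) = f u.
  by rewrite /f rotated_block_permE permK permE blk_next.
apply: leq_trans (card_porbit_le v fp) _.
rewrite -(card_imset _ (@perm_inj _ (t^-1)%g)) /=.
pose b := f v * s.
apply: (@leq_trans #|[pred u : 'I_n | b <= u < b + 2 * s]|).
  apply/subset_leq_card/fintype.subsetP => y /imsetP[u]; rewrite !inE => /eqP fu ->.
  by rewrite /b -fu blk_itv.
rewrite cardE -(size_map val) -[leqRHS](size_iota b).
apply: uniq_leq_size; first by rewrite map_inj_uniq ?enum_uniq //; exact: val_inj.
by move=> x /mapP[y]; rewrite mem_enum inE mem_iota => yb ->.
Qed.

Let changed := [pred v | block_perm v != cycle_perm n v].

(** Only block ends change their successor, and a block has just one end, so block numbers separate
    the changed vertices. *)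
Let card_changed : (#|changed| <= K).
Proof.
have endP v : v \in changed -> block_end v.
  rewrite inE !permE; apply: contraR; rewrite negbK => /[dup] ne /andP[vn _].
  by apply/eqP/val_inj; rewrite /= /next ne modn_small.
rewrite -[K]card_ord.
pose f (v : 'I_n) := Ordinal (blk_lt v).
rewrite -(card_in_imset (f := f) (D := changed)) ?max_card //.
move=> u v /endP eu /endP ev /(congr1 val) /= b.
exact/val_inj/(block_end_inj _ _ eu ev b).
Qed.

(** The list at [v] is unchanged once the images of [v] and of its predecessor on the cycle are. For
    a fixed [w], distinct rotations pull [w] back to distinct vertices, so at most [K] of them hit
    [changed]. *)
Lemma card_rotations_changed (n2 : (2 < n)) v :
  (#|[pred i : 'I_n | nbrs (perm_graph (rotated_block_perm2 i)) v
      != nbrs (perm_graph (cycle_perm2 n2)) v]| <= 2 * K).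
Proof.
set c := cycle_perm n.
pose D w := [pred i : 'I_n | (c ^+ i)^-1%g w \in changed].
have cardD w : (#|D w| <= K).
  apply: leq_trans card_changed.
  rewrite -(@card_in_imset _ _ (fun i : 'I_n => (c ^+ i)^-1%g w) (D w)).
    by apply/subset_leq_card/fintype.subsetP => y /imsetP[i]; rewrite inE => ? ->.
  move=> i j _ _ e; apply: (@cycle_permX_inj _ ((c ^+ i)^-1%g w)).
  by rewrite /= [in RHS]e !permKV.
have unchanged i w : i \notin D w -> rotated_block_perm i w = c w.
  rewrite !inE negbK rotated_block_permE => /eqP ->.
  by rewrite -permM -expgS expgSr permM permKV.
apply: (@leq_trans #|[predU D v & D (c^-1%g v)]|).
  apply/subset_leq_card/fintype.subsetP => i.
  rewrite [in X in X -> _]inE; apply: contraR.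
  rewrite inE negb_or => /andP[/unchanged pv /unchanged qv].
  apply/eqP; rewrite /= pv; congr [:: _; _].
  by apply: (@perm_inj _ (rotated_block_perm i)); rewrite permKV qv permKV.
apply: leq_trans (leq_addr #|[predI D v & D (c^-1%g v)]| _) _.
by rewrite cardUI mul2n -addnn leq_add ?cardD.
Qed.

End Blocks.

Local Open Scope classical_set_scope.
Local Open Scope ring_scope.

(** * From indistinguishability to query complexity *)

Section LowerBound.
Variables (R : realType) (n : nat) (A : local_algorithm R n).

Lemma query_complexity_ub (K : set (graph n)) (G : graph n) (w : seed A) :
  K G -> ((num_queries G (strategy_of w))%:R%:E <= query_complexity A K)%E.
Proof. by move=> KG; apply: ereal_sup_ubound; exists G => //; exists w. Qed.

(** For each seed, disjointness of [B] and [C i] bounds the two probabilities by [1] plus the shift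
    in the probability of [B] between [G] and [G_ i]. The hybrid bound controls the total shift, and
    the seed law has mass [1]. *)
Lemma sum_prob_output_le (I : finType) (N : nat) (q : R) (G : graph n)
    (G_ : I -> graph n) (B : set R) (C : I -> set R) :
  measurable B -> (forall i, measurable (C i)) ->
  (forall i, B `&` C i = set0) ->
  (forall v, (#|[pred i | nbrs (G_ i) v != nbrs G v]| <= N)%N) ->
  (forall w : seed A, (num_queries G (strategy_of w))%:R <= q) ->
  (\sum_i (prob_output_in A G B + prob_output_in A (G_ i) (C i))
    <= (#|I|%:R + N%:R * q)%:E)%E.
Proof.
move=> mB mC BC GN Gq.
pose f i (w : seed A) := ((output_prob G (strategy_of w) B)%:E
  + (output_prob (G_ i) (strategy_of w) (C i))%:E)%E.
have mP (H : graph n) (D : set R) : measurable D ->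
    measurable_fun setT
      (EFin \o (fun w : seed A => output_prob H (strategy_of w) D)).
  by move=> mD; apply/measurable_EFinP; exact: output_prob_measurable.
have mf i : measurable_fun setT (f i) by apply: emeasurable_funD; exact: mP.
have f0 i (w : seed A) : (0 <= f i w)%E.
  by rewrite adde_ge0 // lee_fin output_prob_ge0.
have -> : (\sum_i (prob_output_in A G B + prob_output_in A (G_ i) (C i)) =
    \int[seed_law A]_w \sum_i f i w)%E.
  rewrite ge0_integral_sum //; apply: eq_bigr => i _.
  by rewrite ge0_integralD // => [w _||w _|]; rewrite ?lee_fin ?output_prob_ge0 //;
    exact: mP.
apply: (@le_trans _ _ (\int[seed_law A]_w cst (#|I|%:R + N%:R * q)%:E w)%E); last first.
  by rewrite integral_cst // [X in (_ * X)%E](probability_setT (seed_law A)) mule1.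
apply: ge0_le_integral => //.
- by move=> w _; apply: sume_ge0.
- exact: emeasurable_sum.
move=> w _; rewrite /f /cst.
under eq_bigr do rewrite -EFinD.
rewrite sumEFin lee_fin.
set st := strategy_of w.
apply: (@le_trans _ _ (\sum_i (1 + `|output_prob G st B - output_prob (G_ i) st B|))).
  apply: ler_sum => i _.
  have := output_prob_disjoint_le1 (G_ i) st (BC i).
  have := ler_norm (output_prob G st B - output_prob (G_ i) st B).
  lra.
rewrite big_split /= sumr_const lerD2l.
apply: (le_trans (sum_output_prob_dist st B GN)).
by rewrite natrM ler_wpM2l ?Gq.
Qed.

(** Success on both sides gives [1.2 * #|I| <= #|I| + N * q], hence [N * q >= #|I| / 5], against
    [q < c]. *)
Lemma query_complexity_ge (I : finType) (N : nat) (c : R) (K : set (graph n))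
    (G : graph n) (G_ : I -> graph n) (B : set R) (C : I -> set R) :
  measurable B -> (forall i, measurable (C i)) ->
  (forall i, B `&` C i = set0) -> (0 < #|I|)%N ->
  (forall v, (#|[pred i | nbrs (G_ i) v != nbrs G v]| <= N)%N) ->
  K G -> ((6 / 10)%:E <= prob_output_in A G B)%E ->
  (forall i, ((6 / 10)%:E <= prob_output_in A (G_ i) (C i))%E) ->
  c * N%:R <= #|I|%:R / 5 ->
  (c%:E <= query_complexity A K)%E.
Proof.
move=> mB mC BC I0 GN KG GB GC cN; rewrite leNgt; apply/negP => Ac.
have [q qc Aq] : exists2 q : R, q < c &
    forall w : seed A, (num_queries G (strategy_of w))%:R <= q.
  move: Ac (fun w => query_complexity_ub w KG).
  case: (query_complexity A K) => [r| |] //.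
    by rewrite lte_fin => rc Ar; exists r => // w; rewrite -lee_fin.
  move=> _ Ar; exists (c - 1); first by rewrite gtrBl.
  by move=> w; have := Ar w; rewrite leeNy_eq.
have := sum_prob_output_le mB mC BC GN Aq.
have : (\sum_(i : I) (6 / 10 + 6 / 10)%:E <= 
   \sum_i (prob_output_in A G B + prob_output_in A (G_ i) (C i)))%E.
  by apply: lee_sum => i _; rewrite EFinD leeD.
move=> /le_trans /[apply]; rewrite sumEFin lee_fin sumr_const -mulr_natl.
have I1 : 0 < #|I|%:R :> R by rewrite ltr0n.
have Nq : N%:R * q <= N%:R * c by rewrite ler_wpM2l // ltW.
(* For [N = 0] the bounds already clash; otherwise strictness comes from [q < c]. *)
have [N0|N0] := eqVneq (N%:R : R) 0; first by rewrite N0 mul0r; lra.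
have : N%:R * q < N%:R * c by rewrite ltr_pM2l // lt_neqAle eq_sym N0 /=.
lra.
Qed.

End LowerBound.

(** * The n-cycle against its cut versions *)

Section CycleVersusBlocks.
Variables (R : realType) (n s : nat) (s3 : (2 < s)%N) (sn : (s <= n)%N).
Let n2 : (2 < n)%N := leq_trans s3 sn.
Local Notation cycle_graph := (perm_graph (cycle_perm2 n2)).
Local Notation block_graph i := (perm_graph (rotated_block_perm2 s3 sn i)).

Lemma total_effres_cycle :
  total_effres R cycle_graph = n%:R * (n%:R ^+ 2 - 1) / 12.
Proof.
have n0 : n%:R != 0 :> R by rewrite pnatr_eq0 -lt0n (ltn_trans _ n2).
rewrite total_effres_perm_graph.
under eq_bigr do rewrite card_porbit_cycle.
by rewrite sumr_const card_ord -mulr_natl; field.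
Qed.

Lemma total_effres_blocks_le i :
  total_effres R (block_graph i) <= n%:R ^+ 2 * s%:R / 6.
Proof.
rewrite total_effres_perm_graph.
apply: (@le_trans _ _ (n%:R / 12 * \sum_(u < n) (2 * s)%:R)).
  rewrite ler_wpM2l // ler_sum // => u _.
  by rewrite lerBlDr ler_wpDr ?invr_ge0 // ler_nat card_porbit_rotated.
by rewrite sumr_const card_ord -mulr_natl natrM; lra.
Qed.

(** [accept b] holds the outputs allowed when the true value is [b]: an interval, for measurability,
    within the [ell]-approximations, so that the cycle and the cut graphs share no valid output.
    This form serves both parts. *)
Lemma query_complexity_perm_graphs_ge (A : local_algorithm R n) (ell c : R)
    (K : set (graph n)) (accept : R -> set R) :
  0 < ell -> 4 * ell * s%:R <= n%:R -> c <= s%:R / 10 ->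
  (forall (p : {perm 'I_n}) (p2 : forall v, p (p v) != v), K (perm_graph p2)) ->
  (forall b, is_interval (accept b)) ->
  (forall b, accept b `<=` [set a | approximates ell a b]) ->
  (forall G, K G ->
    ((6 / 10)%:E <= prob_output_in A G (accept (total_effres R G)))%E) ->
  (c%:E <= query_complexity A K)%E.
Proof.
move=> ell0 ells cs Kperm acceptI acceptS AK.
have n1 : 2 < n%:R :> R by rewrite ltr_nat.
have s1 : 0 < s%:R :> R by rewrite ltr0n (ltn_trans _ s3).
have Kperm1 i : K (block_graph i) by exact: Kperm.
have Kcycle : K cycle_graph by exact: Kperm.
apply: (query_complexity_ge (I := 'I_n) (G_ := fun i => block_graph i)
  (B := accept (total_effres R cycle_graph))
  (C := fun i => accept (total_effres R (block_graph i))) _ _ _ _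
  (card_rotations_changed s3 sn n2) Kcycle).
- exact: is_interval_measurable.
- by move=> i; exact: is_interval_measurable.
(* A common output would give [n (n^2 - 1) / 12 <= ell n^2 s / 6 <= n^3 / 24], false for [n > 2]. *)
- move=> i; rewrite -subset0 => a [/acceptS /andP[la _] /acceptS /andP[_ ua]].
  have := le_trans la (le_trans ua (total_effres_blocks_le i)).
  rewrite total_effres_cycle ler_pdivrMr //; apply/negP; rewrite -ltNge.
  have n20 : 0 < n%:R ^+ 2 :> R by rewrite exprn_gt0 //; lra.
  have : n%:R ^+ 2 * (4 * ell * s%:R) <= n%:R ^+ 2 * n%:R by rewrite ler_pM2l.
  have : 2 * 2 * n%:R < n%:R * n%:R * n%:R :> R by rewrite ltr_pM2r ?ltr_pM //; lra.
  rewrite !expr2; lra.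
- by rewrite card_ord (ltn_trans _ n2).
- exact: AK.
- by move=> i; exact: AK.
(* Here [N = 2 (n %/ s)], so [c * N] is at most [s / 10] times [2 n / s], that is [n / 5]. *)
rewrite card_ord natrM.
have Ks : (n %/ s)%N%:R * s%:R <= n%:R :> R by rewrite -natrM ler_nat leq_divM.
have : c * (n %/ s)%N%:R <= s%:R / 10 * (n %/ s)%N%:R by rewrite ler_wpM2r.
lra.
Qed.

End CycleVersusBlocks.

(** * Choice of the block length and constants *)

Theorem theorem15 (R : realType) :
  (exists2 c : R, 0 < c &
     exists n0 : nat, forall n : nat, (n0 <= n)%N ->
     let inputs := [set G : graph n | forall v, (degree G v <= 2)%N] in
     forall A : local_algorithm R n,
       (forall G : graph n, inputs G ->
          ((6 / 10)%:E <= prob_output_in A G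
             [set a | exists C : R,
                (1 < C < 2)%R /\ approximates C a (total_effres R G)])%E) ->
       ((c * n%:R)%:E <= query_complexity A inputs)%E)
  /\
  (exists2 c : R, 0 < c &
     forall ell : nat -> R,
       (forall n : nat, 1 < ell n) ->
       ell =o_\oo (fun n : nat => n%:R : R) ->
     exists n0 : nat, forall n : nat, (n0 <= n)%N ->
     exists m : nat, (n.-1 <= m)%N /\
     let inputs := [set G : graph n | num_edges G = m] in
     forall A : local_algorithm R n,
       (forall G : graph n, inputs G ->
          ((6 / 10)%:E <= prob_output_in A G
             [set a | approximates (ell n) a (total_effres R G)])%E) ->
       ((c * (m%:R / ell n))%:E <= query_complexity A inputs)%E).
Proof.
(* [s] is [n / (4 ell)] rounded down; [12 ell <= n] makes it at least [3], so rounding loses less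
   than half. *)
have block_length (n : nat) (ell : R) : 1 < ell -> 12 * ell <= n%:R ->
    exists s : nat, [/\ (2 < s)%N, (s <= n)%N, 4 * ell * s%:R <= n%:R &
      n%:R / (8 * ell) <= s%:R].
  move=> ell1 elln; have ell0 : 0 < ell by lra.
  pose x := n%:R / (4 * ell).
  have x3 : 3 <= x by rewrite ler_pdivlMr; lra.
  have /andP[sx xs] : (Num.truncn x)%:R <= x < (Num.truncn x).+1%:R.
    by apply: truncn_itv; lra.
  have s3 : (2 < Num.truncn x)%N by rewrite truncn_ge_nat //; lra.
  have xE : x * (4 * ell) = n%:R by rewrite divfK // gt_eqF //; lra.
  have sn : 4 * ell * (Num.truncn x)%:R <= n%:R.
    by rewrite -xE [leRHS]mulrC ler_pM2l //; lra.
  exists (Num.truncn x); split => //.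
    rewrite -(ler_nat R); apply: le_trans sn.
    by rewrite ler_peMl //; lra.
  have -> : n%:R / (8 * ell) = x / 2 by rewrite /x; field; rewrite gt_eqF.
  move: xs; rewrite -natr1; have : 3 <= (Num.truncn x)%:R :> R by rewrite ler_nat.
  lra.
split.
  (* [ell = 2] gives [s >= n / 16], and [s / 10] queries are needed. *)
  exists (1 / 160); first lra.
  exists 24%N => n n24 inputs A HA.
  have [||s [s3 sn es cs]] := block_length n 2; first lra.
    by rewrite -natrM ler_nat.
  apply: (query_complexity_perm_graphs_ge s3 sn (ell := 2)
    (accept := fun b => [set a | exists C : R, 1 < C < 2 /\ approximates C a b])
    _ es _ _ _ _ HA) => //.
  - lra.
  (* The ratio [C] of the lower point works, as the upper end [b] is common to all ratios. *)
  - move=> b x y [C [C12 /andP[bx xb]]] [_ [_ /andP[_ yb]]] z /andP[xz zy].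
    by exists C; split=> //; rewrite /approximates (le_trans bx xz) (le_trans zy yb).
  - move=> b a [C [/andP[C1 C2] /andP[ba ab]]]; rewrite /= /approximates ab andbT.
    have bC : b <= a * C by rewrite -ler_pdivrMr //; lra.
    (* [b / C <= b] with [C > 1] forces [b >= 0]; then [a >= 0] and [C] may be raised to [2]. *)
    have b0 : 0 <= b by nra.
    by rewrite ler_pdivrMr //; nra.
exists (1 / 80); first lra.
(* The little-o bound at [1 / 12] supplies [12 ell <= n]; the edge count is [m = n] by
   2-regularity. *)
move=> ell ell1 /eqoP/(_ (1 / 12))[|n0 _ Hn0]; first lra.
exists n0 => n nn0; exists n; split; first exact: leq_pred.
move=> inputs A HA; have en := ell1 n.
have elln : 12 * ell n <= n%:R.
  have := Hn0 n nn0; rewrite /= normr_nat ger0_norm; lra.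
have [s [s3 sn es cs]] := block_length n (ell n) en elln.
apply: (query_complexity_perm_graphs_ge s3 sn (ell := ell n)
  (accept := fun b => [set a | approximates (ell n) a b]) _ es _ _ _ _ HA).
- lra.
- move: cs; rewrite invfM; lra.
- by move=> p p2; exact: num_edges_perm_graph.
- move=> b x y /andP[bx xb] /andP[by_ yb] z /andP[xz zy].
  by rewrite /= /approximates (le_trans bx xz) (le_trans zy yb).
- by move=> b a.
Qed.
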